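(* Let $q>2$ be an integer, let $B\subset \mathbb{Z}_q\setminus\{0\}$, and let $\mathrm{C}_B$ be the associated set of integers. If $B\subset H\setminus\{0\}$ for some subgroup $H\subset\mathbb{Z}_q$, then every finite non-negative measure $\mu\in \mathrm{M}_{\mathrm{C}_B}(\mathbb{T})$ satisfies $$\dim_{\mathrm{H}}(\mu)\ \geq\ 1-\frac{\log|H|}{\log q}.$$ Moreover, if the inclusion $B\subset H\setminus\{0\}$ is proper, then there exists $\delta>0$, independent of $\mu$, such that every finite non-negative measure $\mu\in \mathrm{M}_{\mathrm{C}_B}(\mathbb{T})$ satisfies $$\dim_{\mathrm{H}}(\mu)\ \geq\ 1-\frac{\log|H|}{\log q}+\delta .$$ In particular, if $B\neq \mathbb{Z}_q\setminus\{0\}$, then there exists $\delta>0$ such that $\dim_{\mathrm{H}}(\mu)>\delta$ for every finite non-negative $\mu\in \mathrm{M}_{\mathrm{C}_B}(\mathbb{T})$.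
   Context: $\mathbb{T}=\mathbb{R}/\mathbb{Z}$. For a finite non-negative Borel measure $\mu$ on $\mathbb{T}$, the lower Hausdorff dimension is $$\dim_{\mathrm{H}}(\mu)=\inf\{\alpha:\ \text{there exists a Borel set } F \text{ with } \mu(F)\neq 0 \text{ and } \dim_{\mathrm{H}}F\leq\alpha\},$$ where $\dim_{\mathrm H}F$ is the Hausdorff dimension of the set $F$ (infimum of the empty set is $+\infty$). Fourier coefficients are $\hat\mu(n)=\int_{\mathbb{T}}e^{-2\pi i n x}\,d\mu(x)$. For $A\subset\mathbb{Z}$, $\mathrm{M}_A(\mathbb{T})$ is the set of finite Borel measures $\mu$ on $\mathbb{T}$ with $\hat\mu(n)=0$ for all $n\in\mathbb{Z}\setminus A$. $\mathbb{Z}_q$ is the group of residues modulo $q$, identified with $\{0,1,\dots,q-1\}$. For $B\subset\{1,\dots,q-1\}$, $$\mathrm{C}_B=\{kq^n:\ k\in\mathbb{Z},\ k \bmod q\in B,\ n\geq 0\}\cup\{0\}.$$ *)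

(* Defs.v *)
From HB Require Import structures.
From mathcomp Require Import all_boot all_order all_algebra all_fingroup.
From mathcomp Require Import generic_quotient ring_quotient complex.
From mathcomp Require Import all_classical all_reals all_analysis.

Set Implicit Arguments.
Unset Strict Implicit.
Unset Printing Implicit Defensive.

Import Order.TTheory GRing.Theory Num.Theory.
Import numFieldNormedType.Exports.

Local Open Scope classical_set_scope.
Local Open Scope ring_scope.
Local Open Scope quotient_scope.

Definition integers (R : realType) : {pred R} := [pred x : R | x \is a Num.int].

Fact integers_zmod_closed (R : realType) : zmod_closed (@integers R).
Proof. by split=> [|x y]; rewrite !inE ?rpred0//; exact: rpredB. Qed.

HB.instance Definition _ (R : realType) :=
  GRing.isZmodClosed.Build R (@integers R) (integers_zmod_closed R).

Definition circle (R : realType) : Type := Quotient.quot (@integers R).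

HB.instance Definition _ (R : realType) := GRing.Zmodule.on (circle R).
HB.instance Definition _ (R : realType) := Quotient.on (circle R).
HB.instance Definition _ (R : realType) :=
  isPointed.Build (circle R) (0 : circle R).

Section circle_metric.
Context {R : realType}.
Local Notation T := (circle R).

Lemma circle_piP (a b : R) :
  \pi_T a = \pi_T b <-> exists m : int, a = b + m%:~R.
Proof.
split=> [/eqP|[m ->]].
  rewrite -(@Quotient.idealrBE _ (@integers R)) => /intrP[m abm].
  by exists m; rewrite -abm addrC subrK.
apply/eqP; rewrite -(@Quotient.idealrBE _ (@integers R)) addrAC subrr add0r.
exact: intr_int.
Qed.

Lemma circle_piD (a b : R) : \pi_T (a + b) = \pi_T a + \pi_T b.
Proof. by rewrite (@pi_addr _ _ _ _ _ (Quotient.quot (@integers R))). Qed.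

Lemma circle_piN (a : R) : \pi_T (- a) = - \pi_T a.
Proof. by rewrite (@pi_oppr _ _ _ _ _ (Quotient.quot (@integers R))). Qed.

Lemma circle_pi0 : \pi_T (0 : R) = 0.
Proof. by rewrite -(subrr (0 : R)) circle_piD circle_piN subrr. Qed.

(* The quotient norm: distance from any lift of x to the nearest integer. *)
Definition circle_norm (x : T) : R :=
  inf [set `|r| | r in [set r : R | \pi_T r = x]].

Definition circle_dist (x y : T) : R := circle_norm (x - y).

Let fiber_has_inf x : has_inf [set `|r| | r in [set r : R | \pi_T r = x]].
Proof.
split; last by exists 0 => _ [r _ <-].
by exists `|repr x|, (repr x) => //=; rewrite reprK.
Qed.

Lemma circle_norm_le (r : R) : circle_norm (\pi_T r) <= `|r|.
Proof. by apply: ge_inf; [exact: (fiber_has_inf _).2|exists r]. Qed.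

Lemma circle_norm_ge0 x : 0 <= circle_norm x.
Proof.
by apply: lb_le_inf; [exact: (fiber_has_inf _).1|move=> _ [r _ <-]].
Qed.

Lemma circle_norm0 : circle_norm 0 = 0.
Proof.
apply/eqP; rewrite eq_le circle_norm_ge0 andbT.
by rewrite -circle_pi0 (le_trans (circle_norm_le _))// normr0.
Qed.

Lemma circle_norm_adherent x (e : R) : 0 < e ->
  exists2 r, \pi_T r = x & `|r| < circle_norm x + e.
Proof.
by move=> e0; have [_ [r <-] <-] := inf_adherent e0 (fiber_has_inf x); exists r.
Qed.

Lemma circle_norm_eq0 x : circle_norm x = 0 -> x = 0.
Proof.
move=> x0; have [f [xf f0 f1]] : exists f, [/\ x = \pi_T f, 0 <= f & f < 1].
  exists (repr x - (Num.floor (repr x))%:~R); split.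
  - rewrite -[LHS]reprK; apply/circle_piP; exists (Num.floor (repr x)).
    by rewrite subrK.
  - by rewrite subr_ge0 floor_le.
  - by rewrite ltrBlDl -(intrD _ _ 1) floorD1_gt.
have [f0E|fN0] := eqVneq f 0; first by rewrite xf f0E circle_pi0.
have e0 : 0 < Num.min f (1 - f) by rewrite lt_min lt0r fN0 f0 subr_gt0.
have [r] := circle_norm_adherent x e0.
rewrite x0 add0r xf => /circle_piP[m ->].
rewrite ltNge => /negP; case.
have [m0|m0] := leP 0 m; rewrite ge_min; apply/orP; [left|right].
  by rewrite (le_trans _ (ler_norm _))// lerDl ler0z.
rewrite -normrN (le_trans _ (ler_norm _))// opprD (addrC 1) lerD2l.
by rewrite -mulrNz ler1z -gtz0_ge1 oppr_gt0.
Qed.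

Lemma circle_normN x : circle_norm (- x) = circle_norm x.
Proof.
congr inf; apply/seteqP; split=> _ [r /= rx <-]; exists (- r);
  by rewrite /= ?normrN// circle_piN rx ?opprK.
Qed.

Lemma circle_normD x y : circle_norm (x + y) <= circle_norm x + circle_norm y.
Proof.
apply/ler_addgt0Pr => e e0; have e20 : 0 < e / 2 by rewrite divr_gt0.
have [r <- rx] := circle_norm_adherent x e20.
have [s <- sy] := circle_norm_adherent y e20.
rewrite -circle_piD (le_trans (circle_norm_le _))// (le_trans (ler_normD _ _))//.
by rewrite [in leRHS](splitr e) addrACA lerD// ltW.
Qed.

Let circle_distxx x : circle_dist x x = 0.
Proof. by rewrite /circle_dist subrr circle_norm0. Qed.

Let circle_dist_positivity x y : circle_dist x y = 0 -> x = y.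
Proof. by move/circle_norm_eq0/eqP; rewrite subr_eq0 => /eqP. Qed.

Let circle_dist_sym x y : circle_dist x y = circle_dist y x.
Proof. by rewrite /circle_dist -circle_normN opprB. Qed.

Let circle_dist_triangle y x z :
  circle_dist x z <= circle_dist x y + circle_dist y z.
Proof. by rewrite /circle_dist -(subrKA y x (- z)) circle_normD. Qed.

HB.instance Definition _ := @isMetric.Build R T circle_dist circle_distxx
  circle_dist_positivity circle_dist_sym circle_dist_triangle.

End circle_metric.

(* The metric topology is the quotient topology of R / Z. *)
Lemma circle_openE (R : realType) (U : set (circle R)) :
  open U <-> open ((\pi_(circle R) : R -> circle R) @^-1` U).
Proof.
have piB a b : \pi_(circle R) (a - b) = \pi_(circle R) a - \pi_(circle R) b.
  by rewrite circle_piD circle_piN.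
rewrite !openE; split=> oU.
- move=> a /= /oU /nbhs_ballP[e /= e0 eU]; apply/nbhs_ballP; exists e => //= b.
  rewrite -ball_normE /= => abe; apply: eU; rewrite ballEmdist /=.
  by rewrite /mdist/= /circle_dist -piB (le_lt_trans (circle_norm_le _)).
- move=> x Ux; have : ((\pi_(circle R) : R -> circle R) @^-1` U) (repr x).
    by rewrite /= reprK.
  move=> /oU /nbhs_ballP[e /= e0 eU]; apply/nbhs_ballP; exists e => //= y.
  rewrite ballEmdist /= /mdist/= /circle_dist => xye.
  have d0 : 0 < e - circle_norm (x - y) by rewrite subr_gt0.
  have [t txy] := circle_norm_adherent (x - y) d0.
  rewrite addrC subrK => te; have := eU (repr x - t).
  rewrite -ball_normE /= opprB addrC subrK => /(_ te).
  by rewrite piB reprK txy opprB addrC subrK.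
Qed.

Definition borel (T : ptopologicalType) := g_sigma_algebraType (@open T).

Section hausdorff.
Context {R : realType} {T : metricType R}.
Implicit Types (A F : set T) (s d : R).
Local Open Scope ereal_scope.

Definition diam A : \bar R :=
  ereal_sup [set (mdist xy.1 xy.2)%:E | xy in A `*` A].

(* [diam set0 = -oo] and [0 `^ 0 = 1]: the empty set always weighs 0, a
   nonempty one weighs 1 when [s = 0]. *)
Definition hausdorff_weight s A : \bar R :=
  if A == set0 then 0 else diam A `^ s.

Definition hausdorff_premeasure s d F : \bar R :=
  ereal_inf [set \sum_(0 <= i <oo) hausdorff_weight s (U i) | U in
    [set U : (set T)^nat |
      F `<=` \bigcup_i U i /\ forall i, diam (U i) <= d%:E]].

Definition hausdorff_measure s F : \bar R :=
  ereal_sup [set hausdorff_premeasure s d F | d in [set d | (0 < d)%R]].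

Definition hausdorff_dim F : \bar R :=
  ereal_inf [set s%:E | s in [set s | (0 <= s)%R /\ hausdorff_measure s F = 0]].

End hausdorff.

Section circle_measures.
Context {R : realType}.
Local Notation T := (borel (circle R)).
Implicit Type mu : {finite_measure set T -> \bar R}.

Definition lower_hausdorff_dim mu : \bar R :=
  ereal_inf [set a%:E | a in [set a : R | exists F : set T,
    [/\ measurable F, mu F != 0%E & (hausdorff_dim F <= a%:E)%E]]].

Definition cis (t : R) : R[i] := (cos t +i* sin t)%C.

Lemma cis_periodic (t : R) (k : int) : cis (t + 2 * pi * k%:~R) = cis t.
Proof.
have cisn (n : nat) u : cis (u + 2 * pi * n%:R) = cis u.
  rewrite mulr_natr (mulrC 2) mulr_natr /cis.
  by rewrite (periodicn (@cosD2pi R)) (periodicn (@sinD2pi R)).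
case: k => n; first exact: cisn.
by rewrite NegzE mulrNz mulrN -[in RHS](subrK (2 * pi * n.+1%:R) t) cisn.
Qed.

Definition complex_integral mu (f : T -> R[i]) : R[i] :=
  (Rintegral mu setT (fun x => complex.Re (f x)) +i*
   Rintegral mu setT (fun x => complex.Im (f x)))%C.

Definition circle_char (n : int) (x : circle R) : R[i] :=
  cis (2 * pi * n%:~R * repr x).

Lemma circle_charE (n : int) (r : R) :
  circle_char n (\pi_(circle R) r) = cis (2 * pi * n%:~R * r).
Proof.
rewrite /circle_char; have [m ->] : exists m : int, repr (\pi_(circle R) r) = r + m%:~R.
  by apply/circle_piP; rewrite reprK.
by rewrite mulrDr -[_ * m%:~R]mulrA -intrM cis_periodic.
Qed.

Definition fourier_coef mu (n : int) : R[i] :=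
  complex_integral mu (circle_char (- n)).

(* [mu \in M_A]; measures are non-negative by typing. *)
Definition spectrum_in (A : set int) mu : Prop :=
  forall n : int, ~ A n -> fourier_coef mu n = 0.

End circle_measures.

(* [k%:~R] is the residue class of [k]; 'Z_q is Z / qZ only for [1 < q]. *)
Definition C_set (q : nat) (B : {set 'Z_q}) : set int :=
  [set m | exists (k : int) (n : nat), k%:~R \in B /\ m = k * q%:Z ^+ n]
  `|` [set 0].

(* Main.v *)
(* Write k = #|B| + 1 and let G(y) = (1/q) |sum_(j < q) e(j y)|^2 be the Fejer
   kernel of order q.  The product of the G(q^l (x - a)) for l < n is the Fejer
   kernel of order q^n centred at a.  Split G according to the residues mod q
   of its frequencies into pieces G_r with |G_r| <= 1.  In the integral against
   mu of G(q^i (x - a)) times the factors with l > i, whose frequencies are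
   multiples of q^(i+1), only the k pieces with r in B or r = 0 contribute, so
   removing a factor costs at most a factor k: the integral of the kernel of
   order q^n is at most k^n mu(T).  As this kernel is of size q^n on the ball of
   radius 1/(8 q^n), such balls have measure O((k/q)^n), and the mass
   distribution principle gives dim mu >= 1 - log k / log q.  The subgroup
   enters only through k <= |H|, resp. k < |H|. *)
Require Import Defs.
From mathcomp Require Import all_boot all_order all_algebra all_fingroup.
From mathcomp Require Import generic_quotient complex ring lra.
From mathcomp Require Import all_classical all_reals all_analysis measurable_realfun.

Local Open Scope ring_scope.

Import Order.TTheory GRing.Theory Num.Theory.
Import numFieldNormedType.Exports.
Set Implicit Arguments.
Unset Strict Implicit.
Unset Printing Implicit Defensive.

(** * Trigonometric functions on the circle *)

Section circle_functions.
Context {R : realType}.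
Local Open Scope classical_set_scope.
Local Notation T := (circle R).
Implicit Types (m : int) (a r : R) (f g : borel T -> R).

Lemma cosD2pi_int (t : R) (k : int) : cos (t + 2 * pi * k%:~R) = cos t.
Proof. by have [] := cis_periodic t k. Qed.

(** The phase [a] puts cosines and sines in one family, whose products are again combinations of its
    members. *)
Definition trig m a (x : T) : R := cos (2 * pi * m%:~R * repr x - a).

Lemma trig_pi m a r : trig m a (\pi_T%qT r) = cos (2 * pi * m%:~R * r - a).
Proof.
have [k] : exists k : int, repr (\pi_T%qT r) = r + k%:~R.
  by apply/circle_piP; rewrite reprK.
rewrite /trig => ->; rewrite -[RHS](cosD2pi_int _ (m * k)) intrM.
by congr cos; ring.
Qed.

(** The section [repr] is not continuous, so openness is tested on the lift to the line, where
    periodicity turns the function into a plain cosine. *)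
Lemma continuous_trig m a : continuous (trig m a : T -> R).
Proof.
apply/continuousP => A oA; apply/circle_openE.
rewrite -comp_preimage.
have -> : trig m a \o \pi_T%qT = (fun r => cos (2 * pi * m%:~R * r - a)).
  by apply/funext => r; rewrite /= trig_pi.
apply: open_comp => // r _; apply: continuous_comp; last exact: continuous_cos.
by apply: cvgB; [apply: cvgMr; exact: cvg_id | exact: cvg_cst].
Qed.

Lemma trigM m k a b (x : T) : trig m a x * trig k b x =
  2^-1 * trig (m + k) (a + b) x + 2^-1 * trig (m - k) (a - b) x.
Proof.
have cosM (u v : R) : cos u * cos v = 2^-1 * cos (u + v) + 2^-1 * cos (u - v).
  by rewrite cosB cosD; field.
rewrite /trig rmorphD rmorphB cosM.
by congr (_ * cos _ + _ * cos _); ring.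
Qed.

Definition bounded_measurable f :=
  measurable_fun setT f /\ exists M, forall x, `|f x| <= M.

Lemma bounded_measurable_trig m a : bounded_measurable (trig m a).
Proof.
split; last by exists 1 => x; rewrite ler_norml cos_geN1 cos_le1.
apply: (measurability _ (RGenOpens.measurableE R)).
move=> _ [_ [y [z ->] <-]]; rewrite setTI; apply: sub_sigma_algebra.
by move/continuousP: (@continuous_trig m a); apply; exact: interval_open.
Qed.

Lemma bounded_measurable_cst a : bounded_measurable (cst a).
Proof. by split; [exact: measurable_cst | exists `|a|]. Qed.

Lemma bounded_measurableM f g : bounded_measurable f -> bounded_measurable g ->
  bounded_measurable (fun x => f x * g x).
Proof.
move=> [mf [M fM]] [mg [N gN]]; split; first exact: measurable_funM.
by exists (M * N) => x; rewrite normrM ler_pM.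
Qed.

Lemma bounded_measurableZ a f : bounded_measurable f ->
  bounded_measurable (fun x => a * f x).
Proof. by apply: bounded_measurableM; exact: bounded_measurable_cst. Qed.

Lemma bounded_measurableD f g : bounded_measurable f -> bounded_measurable g ->
  bounded_measurable (fun x => f x + g x).
Proof.
move=> [mf [M fM]] [mg [N gN]]; split; first exact: measurable_funD.
by exists (M + N) => x; rewrite (le_trans (ler_normD _ _))// lerD.
Qed.

Lemma bounded_measurable_sum (I : Type) (s : seq I) (f : I -> borel T -> R) :
  (forall i, bounded_measurable (f i)) ->
  bounded_measurable (fun x => \sum_(i <- s) f i x).
Proof.
move=> bf; elim: s => [|i s IHs].
  under eq_fun do rewrite big_nil; exact: bounded_measurable_cst.
by under eq_fun do rewrite big_cons; exact: bounded_measurableD.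
Qed.

Section integral.
Variable mu : {finite_measure set borel T -> \bar R}.

Lemma bounded_measurable_integrable f : bounded_measurable f ->
  mu.-integrable setT (EFin \o f).
Proof.
move=> [mf [M fM]]; apply: measurable_bounded_integrable => //.
  by rewrite -ge0_fin_numE// fin_num_measure.
exists M; split; first exact: num_real.
by move=> N MN x _; exact: le_trans (fM x) (ltW MN).
Qed.

Lemma Rintegral_bmD f g : bounded_measurable f -> bounded_measurable g ->
  Rintegral mu setT (fun x => f x + g x) =
  Rintegral mu setT f + Rintegral mu setT g.
Proof. by move=> bf bg; apply: RintegralD => //; exact: bounded_measurable_integrable. Qed.

Lemma Rintegral_bmZ a f : bounded_measurable f ->
  Rintegral mu setT (fun x => a * f x) = a * Rintegral mu setT f.
Proof. by move=> bf; apply: RintegralZl => //; exact: bounded_measurable_integrable. Qed.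

Lemma Rintegral_bm_sum (I : Type) (s : seq I) (f : I -> borel T -> R) :
  (forall i, bounded_measurable (f i)) ->
  Rintegral mu setT (fun x => \sum_(i <- s) f i x) =
  \sum_(i <- s) Rintegral mu setT (f i).
Proof.
move=> bf; elim: s => [|i s IHs].
  under eq_Rintegral do rewrite big_nil.
  by rewrite Rintegral_cst// mul0r big_nil.
under eq_Rintegral do rewrite big_cons.
by rewrite Rintegral_bmD ?IHs ?big_cons//; exact: bounded_measurable_sum.
Qed.

Lemma le_Rintegral_bm f g : bounded_measurable f -> bounded_measurable g ->
  (forall x, f x <= g x) -> Rintegral mu setT f <= Rintegral mu setT g.
Proof.
by move=> bf bg fg; apply: le_Rintegral => //; exact: bounded_measurable_integrable.
Qed.

(** Expanding the phase gives a real combination of the real and imaginary parts of the character of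
    frequency [- m], whose integrals are the two parts of the [m]-th Fourier coefficient. *)
Lemma spectrum_in_trig (A : set int) m a : spectrum_in A mu -> ~ A m ->
  Rintegral mu setT (trig m a) = 0.
Proof.
move=> muA /muA /eqP; rewrite eq_complex /= => /andP[/eqP c0 /eqP s0].
transitivity (Rintegral mu setT
    (fun x : borel T => cos a * trig (- m) 0 x + - sin a * trig (- m) (pi / 2) x)).
  apply: eq_Rintegral => x _; rewrite /trig cosBpihalf subr0 cosB.
  by rewrite intrN !(mulrN, mulNr) cosN sinN; ring.
rewrite Rintegral_bmD ?Rintegral_bmZ;
  try by [do ?apply: bounded_measurableZ; exact: bounded_measurable_trig].
rewrite (_ : Rintegral mu setT (trig (- m) 0) = 0); last first.
  by rewrite -[RHS]c0; apply: eq_Rintegral => x _; rewrite /trig subr0.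
rewrite (_ : Rintegral mu setT (trig (- m) (pi / 2)) = 0) ?mulr0 ?addr0//.
by rewrite -[RHS]s0; apply: eq_Rintegral => x _; rewrite /trig cosBpihalf.
Qed.

End integral.
End circle_functions.

(** * Fejer kernels as Riesz products *)

Section riesz_product.
Context {R : realType} {q : nat}.
Hypothesis q_gt1 : (1 < q)%N.
Local Notation T := (circle R).
Implicit Types (r : 'Z_q) (y : R).

(** The difference is taken between integer representatives: the actual frequency matters, not only
    its residue. *)
Definition ord_diff (j l : 'Z_q) : int := (j : nat)%:Z - (l : nat)%:Z.

Lemma ord_diff_Zq j l : (ord_diff j l)%:~R = j - l :> 'Z_q.
Proof. by rewrite /ord_diff rmorphB /= -!pmulrn !natr_Zp. Qed.

Definition fejer y : R :=
  q%:R^-1 * \sum_(j : 'Z_q) \sum_(l : 'Z_q) cos (2 * pi * (ord_diff j l)%:~R * y).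

(* The part of the Fejer kernel with frequencies congruent to [r] modulo [q]. *)
Definition fejer_class r y : R :=
  q%:R^-1 * \sum_(l : 'Z_q) cos (2 * pi * (ord_diff (l + r) l)%:~R * y).

Let q_gt0 : 0 < q%:R :> R. Proof. by rewrite ltr0n ltnW. Qed.

Lemma card_ordZq : #|'Z_q| = q.
Proof. by rewrite card_ord Zp_cast. Qed.

(** For fixed [l], substitute [j = l + r] in ['Z_q]. *)
Lemma fejer_sum_class y : fejer y = \sum_r fejer_class r y.
Proof.
rewrite /fejer exchange_big /= -mulr_sumr; congr (_ * _).
rewrite [RHS]exchange_big /=; apply: eq_bigr => l _.
by rewrite (reindex_inj (addrI l)).
Qed.

(** Each residue is met by exactly [q] of the [q ^ 2] pairs, one for each [l], and the factor
    [1 / q] compensates. *)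
Lemma fejer_class_le1 r y : fejer_class r y <= 1.
Proof.
rewrite /fejer_class mulrC ler_pdivrMr// mul1r -[leRHS](_ : \sum_(l : 'Z_q) 1 = _).
  by apply: ler_sum => l _; exact: cos_le1.
by rewrite sumr_const card_ordZq.
Qed.

Lemma fejer_sqr y : fejer y = q%:R^-1 *
  ((\sum_(j : 'Z_q) cos (2 * pi * j%:R * y)) ^+ 2 +
   (\sum_(j : 'Z_q) sin (2 * pi * j%:R * y)) ^+ 2).
Proof.
congr (_ * _); rewrite !expr2 !mulr_suml -big_split; apply: eq_bigr => j _ /=.
rewrite !mulr_sumr -big_split; apply: eq_bigr => l _ /=.
by rewrite -cosB /ord_diff rmorphB /= -!pmulrn; congr cos; ring.
Qed.

Lemma fejer_ge0 y : 0 <= fejer y.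
Proof. by rewrite fejer_sqr mulr_ge0 ?invr_ge0 ?ler0n// addr_ge0 ?sqr_ge0. Qed.

Lemma fejer_periodic y (k : int) : fejer (y + k%:~R) = fejer y.
Proof.
congr (_ * _); apply: eq_bigr => j _; apply: eq_bigr => l _.
by rewrite mulrDr -[_ * k%:~R]mulrA -intrM cosD2pi_int.
Qed.

(** Here [t] is the phase at the highest frequency [q - 1]. Cosine decreases on the range
    considered, so all [q] cosines are at least [cos t]; the square of the sine sum is dropped. *)
Lemma fejer_ge y (t := 2 * pi * (q%:R - 1) * y) : 0 <= y -> t <= pi / 2 ->
  q%:R * cos t ^+ 2 <= fejer y.
Proof.
move=> y0 tpi; have pi0 := pi_ge0 R.
have q1 : 1 <= q%:R :> R by rewrite ler1n ltnW.
have t0 : 0 <= t by rewrite /t; do ?apply: mulr_ge0 => //; rewrite subr_ge0.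
have c0 : 0 <= cos t.
  by apply: cos_ge0_pihalf; rewrite tpi andbT (le_trans _ t0)// oppr_le0 divr_ge0.
have le_cos (j : 'Z_q) : cos t <= cos (2 * pi * j%:R * y).
  rewrite leNgt; apply/negP.
  have jq : (j < q)%N by have := ltn_ord j; rewrite [X in (_ < X)%N]Zp_cast.
  have jqR : j%:R <= q%:R - 1 :> R by rewrite lerBrDr natr1 ler_nat.
  have jt : 2 * pi * j%:R * y <= t by rewrite ler_wpM2r// ler_wpM2l// mulr_ge0.
  have j0 : 0 <= 2 * pi * j%:R * y by do ?apply: mulr_ge0 => //; exact: ler0n.
  have pi2 : pi / 2 <= pi :> R by rewrite ler_pdivrMr// ler_peMr// ler1n.
  rewrite ltr_cos ?in_itv /= ?t0 ?j0 ?(le_trans tpi)//.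
    by rewrite ltNge jt.
  exact: le_trans jt (le_trans tpi pi2).
have sum_ge : q%:R * cos t <= \sum_(j : 'Z_q) cos (2 * pi * j%:R * y).
  by rewrite -[q in q%:R]card_ordZq mulr_natl -sumr_const; exact: ler_sum.
rewrite fejer_sqr -ler_pdivrMl ?invr_gt0// invrK mulrA -expr2 -exprMn.
rewrite -[leLHS]addr0 lerD ?sqr_ge0// lerXn2r// nnegrE ?mulr_ge0//.
by rewrite (le_trans _ sum_ge)// mulr_ge0.
Qed.

(** Here [n] counts the factors and [i] is the first scale, so that recursion peels off the factor
    of lowest frequency. *)
Fixpoint riesz (a : R) (n i : nat) (x : borel T) : R :=
  if n is n.+1 then fejer (q%:R ^+ i * (repr x - a)) * riesz a n i.+1 x else 1.

Lemma cos_trig (d : int) (i : nat) a (x : T) :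
  cos (2 * pi * d%:~R * (q%:R ^+ i * (repr x - a))) =
  trig (d * q%:Z ^+ i) (2 * pi * d%:~R * q%:R ^+ i * a) x.
Proof. by rewrite /trig rmorphM rmorphXn /= -pmulrn; congr cos; ring. Qed.

Lemma bounded_measurable_fejer_class a i r :
  bounded_measurable (fun x : borel T => fejer_class r (q%:R ^+ i * (repr x - a))).
Proof.
apply: bounded_measurableZ; apply: bounded_measurable_sum => l.
under eq_fun do rewrite cos_trig; exact: bounded_measurable_trig.
Qed.

Lemma bounded_measurable_riesz a n i : bounded_measurable (riesz a n i).
Proof.
elim: n i => [|n IHn] i /=; first exact: bounded_measurable_cst.
apply: bounded_measurableM => //; under eq_fun do rewrite fejer_sum_class.
by apply: bounded_measurable_sum => r; exact: bounded_measurable_fejer_class.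
Qed.

Lemma riesz_ge0 a n i x : 0 <= riesz a n i x.
Proof. by elim: n i => //= n IHn i; rewrite mulr_ge0// fejer_ge0. Qed.

Lemma bounded_measurable_trig_riesz m b a n i :
  bounded_measurable (fun x : borel T => trig m b x * riesz a n i x).
Proof.
by apply: bounded_measurableM (bounded_measurable_riesz a n i);
  exact: bounded_measurable_trig.
Qed.

(* The frequencies of [riesz a n i] are multiples of [q ^ i], so those of the
   integrand all lie outside [A]. *)
Lemma Rintegral_trig_riesz (mu : {finite_measure set borel T -> \bar R})
    (A : set int) n i (m : int) (a b : R) : spectrum_in A mu ->
  (forall k : int, ~ A (m + q%:Z ^+ i * k)) ->
  Rintegral mu setT (fun x : borel T => trig m b x * riesz a n i x) = 0.
Proof.
move=> muA; elim: n i m b => [|n IHn] i m b mA /=.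
  rewrite -[RHS](spectrum_in_trig b muA (m := m)); last first.
    by have := mA 0; rewrite mulr0 addr0.
  by apply: eq_Rintegral => x _; rewrite mulr1.
(* One term of the first factor, multiplied by [trig m b] and linearized: its frequencies are
   [m + d] and [m - d]. *)
pose h j l (x : borel T) :=
  let d := ord_diff j l * q%:Z ^+ i in
  let c := 2 * pi * (ord_diff j l)%:~R * q%:R ^+ i * a in
  2^-1 * (trig (m + d) (b + c) x * riesz a n i.+1 x) +
  2^-1 * (trig (m - d) (b - c) x * riesz a n i.+1 x).
have bh j l : bounded_measurable (h j l).
  by apply: bounded_measurableD; apply: bounded_measurableZ;
    exact: bounded_measurable_trig_riesz.
transitivity (Rintegral mu setT (fun x => q%:R^-1 *
    \sum_(j : 'Z_q) \sum_(l : 'Z_q) h j l x)).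
  apply: eq_Rintegral => x _; rewrite /fejer -mulrA mulrCA; congr (_ * _).
  rewrite mulrA mulr_sumr mulr_suml; apply: eq_bigr => j _.
  rewrite mulr_sumr mulr_suml; apply: eq_bigr => l _.
  by rewrite cos_trig trigM /h; ring.
(* A shift by a multiple of [q ^ i] stays in the class [m + q ^ i * k], so the induction hypothesis
   applies at scale [i.+1]. *)
have mA' d (k : int) : ~ A (m + d * q%:Z ^+ i + q%:Z ^+ i.+1 * k).
  by have := mA (d + q%:Z * k); rewrite exprSr mulrDr addrA mulrA [_ * d]mulrC.
rewrite Rintegral_bmZ; last by do 2!apply: bounded_measurable_sum => ?.
rewrite Rintegral_bm_sum; last by move=> j; apply: bounded_measurable_sum.
rewrite big1 ?mulr0// => j _; rewrite Rintegral_bm_sum// big1// => l _.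
rewrite Rintegral_bmD; last 2 first.
- by apply: bounded_measurableZ; exact: bounded_measurable_trig_riesz.
- by apply: bounded_measurableZ; exact: bounded_measurable_trig_riesz.
rewrite !Rintegral_bmZ; try exact: bounded_measurable_trig_riesz.
by rewrite !IHn ?mulr0 ?addr0// -mulNr.
Qed.

End riesz_product.

(** * Measure of small balls under the spectral condition *)

Section measure_of_balls.
Context {R : realType} {q : nat}.
Hypothesis q_gt1 : (1 < q)%N.
Local Notation T := (circle R).
Implicit Types (y a : R).

Let qR_gt0 : 0 < q%:R :> R. Proof. by rewrite ltr0n ltnW. Qed.

(** Compare the powers of [q] in [q ^ i * k = k' * q ^ n], where [q] does not divide [k']. If
    [i < n] then [q] divides [k]; if [i = n] then [k = k']; [n < i] is impossible. *)
Lemma C_set_Zq (B : {set 'Z_q}) (k : int) (i : nat) : B \subset [set~ 0] ->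
  C_set B (q%:Z ^+ i * k) -> k%:~R \in 0 |: B.
Proof.
move=> B0; have q0 : q%:Z != 0 by rewrite eqz_nat -lt0n ltnW.
have qZ0 (c : int) n : (c * q%:Z ^+ n.+1)%:~R = 0 :> 'Z_q.
  by rewrite exprS mulrCA rmorphM /= -pmulrn pchar_Zp// mul0r.
case=> [[k' [n [k'B]]]|/eqP]; last first.
  by rewrite mulf_eq0 expf_eq0 (negPf q0) andbF => /eqP ->; rewrite !inE mulr0z eqxx.
have k'0 : k'%:~R != 0 :> 'Z_q by have := fintype.subsetP B0 _ k'B; rewrite !inE.
rewrite mulrC; have [|/subnKC <-] := ltnP i n.
  move=> /subnKC <-; rewrite addSnnS exprD mulrCA mulrC.
  by move=> /(mulfI (expf_neq0 _ q0)) ->; rewrite qZ0 !inE eqxx.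
rewrite exprD mulrCA mulrC => /(mulIf (expf_neq0 _ q0)).
case: (i - n)%N => [|m] kE; first by move: kE; rewrite expr0 mulr1 => ->; rewrite !inE k'B orbT.
by move: k'0; rewrite -kE qZ0 eqxx.
Qed.

Lemma fejer_norm y : fejer (q := q) `|y| = fejer (q := q) y.
Proof.
case: (ger0P y) => // _; rewrite !fejer_sqr; congr (_ * (_ + _)).
  by congr (_ ^+ 2); apply: eq_bigr => j _; rewrite mulrN cosN.
by rewrite -sqrrN -sumrN; congr (_ ^+ 2); apply: eq_bigr => j _; rewrite mulrN sinN opprK.
Qed.

(** The phases of the single factors telescope to [t], and for angles in the first quadrant a
    product of cosines is at least the cosine of the sum. The integer [k] accounts for the choice of
    lift made by [repr]. *)
Lemma riesz_ge n i y a (k : int) (x : T)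
    (t := 2 * pi * (q%:R ^+ (i + n) - q%:R ^+ i) * `|y|) :
  repr x = a + y + k%:~R -> t <= pi / 2 ->
  q%:R ^+ n * cos t ^+ 2 <= riesz (q := q) a n i x.
Proof.
move=> xE; rewrite {}/t.
have pi0 := pi_ge0 R; have q1 : 1 <= q%:R :> R by rewrite ler1n ltnW.
elim: n i => [|n IHn] i /=.
  by rewrite addn0 subrr mulr0 mul0r cos0 expr1n mulr1.
set t := 2 * pi * _ * _ => tpi.
pose t1 := 2 * pi * (q%:R - 1) * (q%:R ^+ i * `|y|).
pose t2 := 2 * pi * (q%:R ^+ (i.+1 + n) - q%:R ^+ i.+1) * `|y|.
have tE : t = t1 + t2 by rewrite /t /t1 /t2 addSnnS exprS; ring.
have qi0 m : 0 <= q%:R ^+ m :> R by rewrite exprn_ge0.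
have t10 : 0 <= t1 by rewrite /t1; do ?apply: mulr_ge0 => //; rewrite subr_ge0.
have t20 : 0 <= t2.
  rewrite /t2 exprD -{2}[q%:R ^+ i.+1]mulr1 -mulrBr.
  by do ?apply: mulr_ge0 => //; rewrite subr_ge0 exprn_ege1.
have t1pi : t1 <= pi / 2 by rewrite (le_trans _ tpi)// tE lerDl.
have t2pi : t2 <= pi / 2 by rewrite (le_trans _ tpi)// tE lerDr.
have npi t' : 0 <= t' -> - (pi / 2) <= t' :> R.
  by apply: le_trans; rewrite oppr_le0 divr_ge0.
have sin_ge0 t' : 0 <= t' -> t' <= pi / 2 -> 0 <= sin t' :> R.
  move=> t'0 t'pi; apply: sin_ge0_pi; rewrite t'0 (le_trans t'pi)//.
  by rewrite ler_pdivrMr// ler_peMr// ler1n.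
have := IHn i.+1 t2pi; rewrite -/t2 => IH.
(* The integer [q ^ i * k] disappears by periodicity, the sign of [y] by evenness. *)
have fE : fejer (q := q) (q%:R ^+ i * (repr x - a)) = fejer (q := q) (q%:R ^+ i * `|y|).
  rewrite xE [a + y]addrC addrAC addrK.
  have -> : q%:R ^+ i * (y + k%:~R) = q%:R ^+ i * y + (q%:Z ^+ i * k)%:~R :> R.
    by rewrite mulrDr rmorphM rmorphXn.
  by rewrite fejer_periodic -[LHS]fejer_norm normrM ger0_norm.
rewrite fE (le_trans _ (ler_pM _ _ (fejer_ge q_gt1 _ t1pi) IH))
  ?(mulr_ge0 (ltW qR_gt0) (sqr_ge0 _)) ?(mulr_ge0 (qi0 _) (sqr_ge0 _))
  ?(mulr_ge0 (qi0 i) (normr_ge0 y))//.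
rewrite -/t1 exprS [leRHS]mulrACA -exprMn ler_wpM2l ?mulr_ge0//.
have ct0 : 0 <= cos t.
  by rewrite cos_ge0_pihalf// tpi npi// tE addr_ge0.
have ct : cos t <= cos t1 * cos t2 by rewrite tE cosD gerBl mulr_ge0 ?sin_ge0.
by rewrite lerXn2r// nnegrE (le_trans ct0).
Qed.

Section spectrum.
Variables (mu : {finite_measure set borel T -> \bar R}) (B : {set 'Z_q}).
Hypotheses (B0 : B \subset [set~ 0]) (muB : spectrum_in (C_set B) mu).

Lemma Rintegral_riesz_step a n i :
  Rintegral mu setT (riesz (q := q) a n.+1 i) <=
  #|B|.+1%:R * Rintegral mu setT (riesz (q := q) a n i.+1).
Proof.
pose g (r : 'Z_q) (x : borel T) :=
  fejer_class r (q%:R ^+ i * (repr x - a)) * riesz (q := q) a n i.+1 x.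
have bz := bounded_measurable_riesz a n i.+1 (q := q).
have bg r : bounded_measurable (g r).
  by apply: bounded_measurableM; [exact: bounded_measurable_fejer_class | exact: bz].
have -> : Rintegral mu setT (riesz (q := q) a n.+1 i) =
    \sum_(r : 'Z_q) Rintegral mu setT (g r).
  rewrite -Rintegral_bm_sum//; apply: eq_Rintegral => x _ /=.
  by rewrite fejer_sum_class mulr_suml.
rewrite (bigID [pred r | r \in 0 |: B]) /= [X in _ + X]big1 ?addr0; last first.
  move=> r rB; pose h l (x : borel T) :=
    let d := ord_diff (l + r) l in
    trig (d * q%:Z ^+ i) (2 * pi * d%:~R * q%:R ^+ i * a) x *
    riesz (q := q) a n i.+1 x.
  have bh l : bounded_measurable (h l) by exact: bounded_measurable_trig_riesz.
  transitivity (Rintegral mu setT (fun x => q%:R^-1 * \sum_(l : 'Z_q) h l x)).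
    apply: eq_Rintegral => x _; rewrite /g /fejer_class -mulrA; congr (_ * _).
    by rewrite mulr_suml; apply: eq_bigr => l _; rewrite cos_trig.
  rewrite Rintegral_bmZ; last exact: bounded_measurable_sum.
  rewrite Rintegral_bm_sum// big1 ?mulr0// => l _.
  (* The frequencies are [q ^ i * (d + q * k)] with [d] congruent to [r]; one of them in [C_set B]
     would put [r] in [0 |: B]. *)
  rewrite /h /=; apply: Rintegral_trig_riesz muB _ => k.
  rewrite mulrC exprSr -mulrA -mulrDr => /(C_set_Zq B0).
  rewrite rmorphD rmorphM /= -[q%:~R]pmulrn pchar_Zp// mul0r addr0 ord_diff_Zq.
  by rewrite addrC addKr (negPf rB).
have -> : #|B|.+1 = #|0 |: B|.
  by rewrite cardsU1; case: (boolP (0 \in B)) => // /(fintype.subsetP B0); rewrite !inE eqxx.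
rewrite mulr_natl -sumr_const; apply: ler_sum => r _.
apply: le_Rintegral_bm => // x; rewrite ler_piMl ?riesz_ge0//.
exact: fejer_class_le1.
Qed.

Lemma Rintegral_riesz_le a n i :
  Rintegral mu setT (riesz (q := q) a n i) <=
  #|B|.+1%:R ^+ n * fine (mu setT).
Proof.
elim: n i => [|n IHn] i; first by rewrite /= Rintegral_cst.
apply: le_trans (Rintegral_riesz_step _ _ _) _.
by rewrite exprS -mulrA ler_wpM2l// IHn.
Qed.

(** Markov's inequality for the Riesz product centred at [a]: [V] is the set where it is at least
    [q ^ n * c], which contains the ball. *)
Lemma measure_small_ball (c := cos (pi / 4) ^+ 2 : R) (a : R) n :
  exists V : set (borel T), [/\ measurable V,
    forall x, circle_norm (x - \pi_T%qT a) < (8 * q%:R ^+ n)^-1 -> V x &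
    (mu V <= (fine (mu setT) / c * (#|B|.+1%:R / q%:R) ^+ n)%:E)%E].
Proof.
have pi0 := pi_gt0 R.
have cos0 : 0 < cos (pi / 4) :> R.
  by apply: cos_gt0_pihalf; apply/andP; split; lra.
have c0 : 0 < c by rewrite /c exprn_gt0.
have qn0 : 0 < q%:R ^+ n :> R by rewrite exprn_gt0.
have [mr [M rM]] := bounded_measurable_riesz a n 0 (q := q).
pose V := (riesz (q := q) a n 0 @^-1` `[q%:R ^+ n * c, +oo[)%classic.
have mV : measurable V.
  by rewrite -[V]setTI; apply: mr => //; exact: measurable_itv.
exists V; split => // [x xa|].
  have e0 : 0 < (8 * q%:R ^+ n)^-1 - circle_norm (x - \pi_T%qT a) by rewrite subr_gt0.
  have [y yx] := circle_norm_adherent (x - \pi_T%qT a) e0.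
  rewrite addrCA subrr addr0 => yq.
  have [k xE] : exists k : int, repr x = a + y + k%:~R.
    by apply/circle_piP; rewrite reprK circle_piD yx addrCA subrr addr0.
  rewrite /V /= in_itv /= andbT.
  (* The radius [1 / (8 q ^ n)] is chosen to keep the total phase below [pi / 4], whence the
     constant [c]. *)
  have tpi : 2 * pi * (q%:R ^+ (0 + n) - q%:R ^+ 0) * `|y| <= pi / 4.
    rewrite add0n expr0.
    have : q%:R ^+ n * `|y| <= 8^-1.
      by rewrite -ler_pdivlMl// -invfM mulrC ltW.
    have := normr_ge0 y; nra.
  have t0 : 0 <= 2 * pi * (q%:R ^+ (0 + n) - q%:R ^+ 0) * `|y|.
    do ?apply: mulr_ge0 => //; first exact: ltW.
    by rewrite subr_ge0 expr0 exprn_ege1// ler1n ltnW.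
  apply: le_trans (riesz_ge (n := n) (i := 0) xE _); last by lra.
  rewrite ler_wpM2l ?(ltW qn0)// lerXn2r// ?nnegrE ?(ltW cos0)//.
    by rewrite cos_ge0_pihalf//; apply/andP; split; lra.
  rewrite leNgt ltr_cos ?in_itv /=; last 2 first.
  - by apply/andP; split; lra.
  - by apply/andP; split; lra.
  by rewrite -leNgt.
have muV : mu V = (fine (mu V))%:E by rewrite fineK// fin_num_measure.
rewrite muV lee_fin.
have bV : bounded_measurable (\1_V : borel T -> R).
  split; first exact: measurable_indic.
  by exists 1 => x; rewrite indicE; case: (_ \in _) => /=; rewrite ?normr0 ?normr1.
have intV : q%:R ^+ n * c * fine (mu V) <= #|B|.+1%:R ^+ n * fine (mu setT).
  have -> : fine (mu V) = Rintegral mu setT (\1_V : borel T -> R).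
    by rewrite /Rintegral integral_indic// setIT.
  apply: le_trans (Rintegral_riesz_le a n 0); rewrite -Rintegral_bmZ//.
  apply: le_Rintegral_bm.
  - exact: bounded_measurableZ.
  - exact: bounded_measurable_riesz.
  - move=> x; rewrite indicE; case: (boolP (x \in V)) => [/set_mem|_] /=.
      by rewrite /V /= in_itv /= andbT mulr1.
    by rewrite mulr0 riesz_ge0.
rewrite (_ : _ * _ = #|B|.+1%:R ^+ n * fine (mu setT) / (q%:R ^+ n * c)).
  by rewrite ler_pdivlMr ?mulr_gt0// mulrC.
by rewrite expr_div_n; field; rewrite !gt_eqF.
Qed.

End spectrum.
End measure_of_balls.

(** * Mass distribution *)

Section mass_distribution.
Context {R : realType}.
Local Notation T := (circle R).
Local Open Scope classical_set_scope.
Local Open Scope ereal_scope.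

(** The pieces of a Hausdorff cover are arbitrary sets, so the hypothesis supplies measurable
    enlargements, whose masses are then summed. *)
Lemma mass_distribution (mu : {finite_measure set borel T -> \bar R})
    (F : set (borel T)) (t K d : R) : (0 < d)%R -> (0 <= K)%R ->
  (forall U : set T, U !=set0 -> diam U <= d%:E ->
    exists V : set (borel T),
      [/\ measurable V, U `<=` V & mu V <= K%:E * hausdorff_weight t U]) ->
  measurable F -> hausdorff_measure t (F : set T) = 0 -> mu F = 0.
Proof.
move=> d0 K0 cover mF HF0.
have mFE : mu F = (fine (mu F))%:E by rewrite fineK// fin_num_measure.
apply/eqP; rewrite eq_le measure_ge0 andbT leNgt; apply/negP => mF0.
have m0 : (0 < fine (mu F))%R by rewrite -lte_fin -mFE.
have K10 : (0 < K + 1)%R by rewrite ltr_pwDr.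
(* With [K + 1] as denominator, [K * e < mu F] holds even for [K = 0]; a cover of weight below [e]
   is then contradictory. *)
set e := (fine (mu F) / (K + 1))%R.
have e0 : (0 < e)%R by rewrite divr_gt0.
have : hausdorff_premeasure t d (F : set T) < e%:E.
  rewrite (@le_lt_trans _ _ 0) ?lte_fin// -HF0.
  by apply: ereal_sup_ubound; exists d.
move=> /ereal_inf_lt[_ [U [FU Ud] <-] Ue].
have w0 (A : set T) : 0 <= hausdorff_weight t A.
  by rewrite /hausdorff_weight; case: ifP => // _; exact: poweR_ge0.
have /choice[V UV] i : exists V : set (borel T),
    [/\ measurable V, U i `<=` V & mu V <= K%:E * hausdorff_weight t (U i)].
  have [U0|/set0P/cover] := eqVneq (U i) set0; last by apply.
  exists set0; split; [exact: measurable0 | by rewrite U0 |].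
  by rewrite measure0 mule_ge0.
have FV : F `<=` \bigcup_i V i.
  by move=> x /FU [i _ Uix]; exists i => //; have [_ + _] := UV i; exact.
have muF : mu F <= K%:E * e%:E.
  have mV i : measurable (V i) by have [] := UV i.
  apply: le_trans (measure_sigma_subadditive mu mV mF FV) _.
  apply: le_trans (_ : _ <= \sum_(0 <= i <oo) (K%:E * hausdorff_weight t (U i))) _.
    by apply: lee_nneseries => // i _; have [] := UV i.
  rewrite nneseriesZl; last by move=> i _; exact: w0.
  by rewrite lee_wpmul2l ?lee_fin// ltW.
move: muF; rewrite mFE -EFinM lee_fin /e leNgt => /negP; apply.
by rewrite mulrA ltr_pdivrMr// mulrDr mulr1 mulrC ltrDl.
Qed.

End mass_distribution.

(** * Lower bound for the dimension in terms of the cardinality of [B] *)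

Section dimension.
Context {R : realType} {q : nat}.
Hypothesis q_gt1 : (1 < q)%N.
Local Notation T := (circle R).
Variables (mu : {finite_measure set borel T -> \bar R}) (B : {set 'Z_q}).
Hypotheses (B0 : B \subset [set~ 0]) (muB : spectrum_in (C_set B) mu).
Let rho : R := #|B|.+1%:R / q%:R.

Local Open Scope classical_set_scope.

Let qR_gt0 : 0 < q%:R :> R. Proof. by rewrite ltr0n ltnW. Qed.

Lemma exists_scale (r : R) : 0 < r -> r < 8^-1 ->
  exists n, (8 * q%:R ^+ n.+1)^-1 <= r < (8 * q%:R ^+ n)^-1.
Proof.
move=> r0 r8; pose P n := (8 * q%:R ^+ n.+1)^-1 <= r.
have q0 n : 0 < 8 * q%:R ^+ n :> R by rewrite mulr_gt0// exprn_gt0.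
have exP : exists n, P n.
  exists (Num.truncn r^-1); rewrite /P -[leRHS]invrK lef_pV2 ?posrE ?invr_gt0//.
  apply: le_trans (ltW (truncnS_gt _)) _; rewrite -natrX -natrM ler_nat.
  by rewrite (leq_trans (ltnW (ltn_expl _ q_gt1)))// leq_pmull.
(* At the least such [n], the upper bound is [r < 1 / 8] if [n = 0], and minimality otherwise. *)
case: (ex_minnP exP) => -[|n] Pn minP; first by exists 0%N; rewrite (Pn : is_true (_ <= r)) expr0 mulr1.
exists n.+1; rewrite (Pn : is_true (_ <= r)) /= ltNge; apply/negP => /minP.
by rewrite ltnn.
Qed.

(** The condition on [t] says [rho < q ^ (- t)]. At the scale [n] of the diameter [r], the mass is
    at most [C * rho ^ n], hence at most [C * q ^ (- t n)], and [q ^ (- n) <= 8 q r]. The threshold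
    [1 / 16] keeps [r] below [1 / 8]. *)
Lemma measure_le_weight (t : R) : 0 <= t -> t < 1 - ln #|B|.+1%:R / ln q%:R ->
  exists2 K : R, 0 <= K & forall U : set T, U !=set0 -> (diam U <= 16^-1%:E)%E ->
    exists V : set (borel T), [/\ measurable V, U `<=` V &
      (mu V <= K%:E * hausdorff_weight t U)%E].
Proof.
move=> t0 ts.
have lnq : 0 < ln q%:R :> R by rewrite ln_gt0// ltr1n.
have rho0 : 0 < rho by rewrite /rho divr_gt0.
have rhoq : rho < q%:R^-1 `^ t.
  rewrite -ltr_ln ?posrE ?powR_gt0 ?invr_gt0// ln_powR lnV ?posrE// ln_div ?posrE//.
  by move: ts; rewrite ltrBrDl -ltrBrDr ltr_pdivrMr//; lra.
set C := fine (mu setT) / cos (pi / 4) ^+ 2 : R.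
have C0 : 0 <= C by rewrite divr_ge0 ?fine_ge0 ?sqr_ge0.
exists (C * (8 * q%:R) `^ t) => [|U [u Uu] diamU]; first by rewrite mulr_ge0// powR_ge0.
have dist_le x : U x -> ((circle_norm (x - u))%:E <= diam U)%E.
  by move=> Ux; apply: ereal_sup_ubound; exists (x, u).
have /choice[V UV] := measure_small_ball q_gt1 B0 muB (repr u).
rewrite reprK in UV.
have diam0 : (0%E <= diam U)%E by rewrite (le_trans _ (dist_le u Uu))// lee_fin circle_norm_ge0.
have diamE : diam U = (fine (diam U))%:E.
  by rewrite fineK// ge0_fin_numE// (le_lt_trans diamU)// ltry.
move: diamU diam0 dist_le; rewrite /hausdorff_weight ifF; last first.
  by apply/negP => /eqP U0; move: Uu; rewrite U0.
rewrite {}diamE; move: (fine (diam U)) => r; rewrite !lee_fin => r16 r0 dist_le.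
rewrite poweR_EFin -EFinM.
have [r0E|rN0] := eqVneq r 0; last first.
  have r_gt0 : 0 < r by rewrite lt0r rN0.
  have [n /andP[rn nr]] : exists n, (8 * q%:R ^+ n.+1)^-1 <= r < (8 * q%:R ^+ n)^-1.
    by apply: exists_scale => //; lra.
  have [mV ballV muV] := UV n; exists (V n); split => //.
    by move=> x Ux; apply: ballV; rewrite (le_lt_trans _ nr)// -lee_fin dist_le.
  apply: le_trans muV _; rewrite lee_fin -/C -/rho -[leRHS]mulrA ler_wpM2l//.
  apply: le_trans (_ : (q%:R^-1 `^ t) ^+ n <= _).
    by rewrite lerXn2r// ?nnegrE ?powR_ge0// ltW.
  rewrite -powR_mulrn ?powR_ge0// powRAC -powRM ?mulr_ge0//.
  rewrite ge0_ler_powR// ?nnegrE ?powR_ge0 ?mulr_ge0//.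
  rewrite powR_mulrn ?invr_ge0// exprVn mulrC -ler_pdivrMr ?mulr_gt0//.
  by rewrite -invfM mulrCA -exprSr.
(* A set of diameter zero has no scale of its own: it lies in every [V n], and the intersection is
   used. *)
have Ux0 n x : U x -> V n x.
  move=> Ux; have [_ + _] := UV n; apply; rewrite (@le_lt_trans _ _ 0)//.
    by rewrite -r0E -lee_fin dist_le.
  by rewrite invr_gt0 mulr_gt0// exprn_gt0.
have mV n : measurable (V n) by have [] := UV n.
have mbV : measurable (\bigcap_n V n) by exact: bigcapT_measurable.
exists (\bigcap_n V n); split => //; first by move=> x Ux n _; exact: Ux0.
have muV n : (mu (\bigcap_n V n) <= (C * rho ^+ n)%:E)%E.
  have [_ _] := UV n; apply: le_trans; apply: le_measure; rewrite ?inE//.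
  exact: bigcap_inf.
(* For [t = 0] the weight is [0 ^ 0 = 1] and the bound at [n = 0] suffices; for [t > 0] the weight
   is 0, so the mass must vanish, which follows from [rho < 1]. *)
have [t0E|tN0] := eqVneq t 0.
  by rewrite t0E r0E !powRr0 !mulr1; have := muV 0%N; rewrite expr0 mulr1.
rewrite r0E powR0// mulr0.
have muVE : mu (\bigcap_n V n) = (fine (mu (\bigcap_n V n)))%:E.
  by rewrite fineK// fin_num_measure.
move: muV; rewrite muVE lee_fin; move: (fine _) => v vC.
have rho1 : `|rho| < 1.
  rewrite ger0_norm ?(ltW rho0)// (lt_le_trans rhoq)//.
  rewrite -[leRHS](powRr0 (q%:R^-1)) ger_powR// invr_gt0 qR_gt0 invf_le1//.
  by rewrite ler1n ltnW.
have Crho : (C * rho ^+ n) @[n --> \oo] --> 0.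
  by rewrite -[X in _ --> X](mulr0 C); apply: cvgMr; exact: cvg_expr.
rewrite -(cvg_lim _ Crho)//; apply: limr_ge; first by apply/cvg_ex; exists 0.
by apply: nearW => n; rewrite -lee_fin.
Qed.

(** For a set [F] of nonzero mass, an exponent [t] below the bound with zero Hausdorff measure would
    contradict mass distribution. *)
Lemma lower_hausdorff_dim_ge :
  ((1 - ln #|B|.+1%:R / ln q%:R)%:E <= lower_hausdorff_dim mu)%E.
Proof.
apply: le_ereal_inf_tmp => _ [a [F [mF muF0 Fa]] <-]; apply: le_trans Fa.
apply: le_ereal_inf_tmp => _ [t [t0 HFt] <-]; rewrite lee_fin leNgt; apply/negP => ts.
have [K K0 UV] := measure_le_weight t0 ts.
by move/eqP: muF0; apply; apply: mass_distribution K0 UV mF HFt; rewrite invr_gt0.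
Qed.

End dimension.

(** * Comparison of [B] with subgroups and with all nonzero residues *)

Theorem theorem1p3 (R : realType) (q : nat) (hq : (2 < q)%N)
    (B : {set 'Z_q}) (hB : B \subset [set~ 0]) :
  (forall H : {group 'Z_q}, B \subset H :\ 0 ->
     (forall mu : {finite_measure set borel (circle R) -> \bar R},
        spectrum_in (C_set B) mu ->
        ((1 - ln #|H|%:R / ln q%:R)%:E <= lower_hausdorff_dim mu)%E)
     /\
     (B \proper H :\ 0 ->
        exists2 delta : R, 0 < delta &
          forall mu : {finite_measure set borel (circle R) -> \bar R},
            spectrum_in (C_set B) mu ->
            ((1 - ln #|H|%:R / ln q%:R + delta)%:E <= lower_hausdorff_dim mu)%E))
  /\
  (B != [set~ 0] ->
     exists2 delta : R, 0 < delta &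
       forall mu : {finite_measure set borel (circle R) -> \bar R},
         spectrum_in (C_set B) mu -> (delta%:E < lower_hausdorff_dim mu)%E).
Proof.
have q_gt1 : (1 < q)%N by rewrite ltnW.
have lnq : 0 < ln q%:R :> R by rewrite ln_gt0// ltr1n.
have dimB (mu : {finite_measure set borel (circle R) -> \bar R}) :=
  lower_hausdorff_dim_ge q_gt1 (mu := mu) hB.
have lt_lnq (m n : nat) : (0 < m)%N -> (m < n)%N -> ln m%:R / ln q%:R < ln n%:R / ln q%:R :> R.
  move=> m0 mn; rewrite ltr_pM2r ?invr_gt0// ltr_ln ?posrE ?ltr0n ?ltr_nat//.
  exact: leq_trans mn.
split=> [H BH|BN].
  (* The neutral element of the group ['Z_q] is 0, so it lies in [H]. *)
  have cardH : #|H| = #|H :\ 0|.+1 by rewrite (cardsD1 0 H) (group1 H).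
  split=> [mu muB|/proper_card BHlt].
    apply: le_trans (dimB mu muB); rewrite lee_fin lerD2l lerN2 cardH.
    have := subset_leq_card BH; rewrite leq_eqVlt => /orP[/eqP -> //|BHlt].
    by rewrite ltW// lt_lnq.
  exists (ln #|H|%:R / ln q%:R - ln #|B|.+1%:R / ln q%:R).
    by rewrite subr_gt0 lt_lnq// cardH.
  by move=> mu muB; rewrite subrKA; exact: dimB.
have cardB : (#|B|.+1 < q)%N.
  have /proper_card : B \proper [set~ 0] by rewrite finset.properEneq BN.
  by rewrite cardsC1 card_ordZq// -ltnS prednK// ltnW.
have := lt_lnq _ _ (ltn0Sn #|B|) cardB; rewrite divff ?gt_eqF// => lt1.
(* Half of the positive lower bound, to make the inequality strict. *)
exists ((1 - ln #|B|.+1%:R / ln q%:R) / 2); first by rewrite divr_gt0// subr_gt0.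
move=> mu muB; apply: lt_le_trans (dimB mu muB).
by rewrite lte_fin ltr_pdivrMr// ltr_pMr ?subr_gt0// ltr1n.
Qed.
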